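(* There is an algebraic weak factorization system $(\mathsf{L},\mathsf{R})$ on the category $\mathsf{cSet}$ of cartesian cubical sets whose $\mathsf{R}$-algebras are exactly the uniform Kan fibrations: for every map $f:Y\to X$, $\mathsf{R}$-algebra structures on $f$ correspond to uniform Kan fibration structures on $f$.
   Context: Let $\mathbb{B}$ be the category of finite sets $[n]=\{\bot,x_1,\dots,x_n,\top\}$ ($n\ge0$, $\bot\ne\top$) and functions preserving $\bot,\top$; $\mathsf{cSet}$ is the category of presheaves on $\mathbb{B}^{op}$. $\mathrm{I}^n$ is the representable on $[n]$, $\mathrm{I}^n\cong\mathrm{I}\times\dots\times\mathrm{I}$, $\mathrm{I}=\mathrm{I}^1$, $\mathrm{I}^0=1$; the two maps $[1]\to[0]$ give endpoints $0,1:1\to\mathrm{I}$. For $1\le i\le n$, $d\in\{0,1\}$, the face $\alpha_i^d:\mathrm{I}^{n-1}\to\mathrm{I}^n$ inserts $d$ in coordinate $i$; for $e\in\{0,1\}$ the open box $\sqcup^n_e\rightarrowtail\mathrm{I}^n$ is the union of the images of all faces $\alpha_i^d$ with $(i,d)\ne(1,e)$, with inclusion $i^n_e$. A uniform Kan fibration structure on $f:Y\to X$ consists of, for each $n\ge1$, $e\in\{0,1\}$, $k\ge1$, and each commutative square $b:\mathrm{I}^k\times\sqcup^n_e\to Y$, $a:\mathrm{I}^k\times\mathrm{I}^n\to X$ with $fb=a\circ(1\times i^n_e)$, a chosen diagonal filler $\phi(a,b):\mathrm{I}^k\times\mathrm{I}^n\to Y$ (so $\phi(a,b)\circ(1\times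 i^n_e)=b$ and $f\phi(a,b)=a$), such that for every map $\alpha:\mathrm{I}^j\to\mathrm{I}^k$ ($j\ge1$), $\phi(a,b)\circ(\alpha\times1)=\phi(a\circ(\alpha\times1),b\circ(\alpha\times1))$. An algebraic weak factorization system on a category $\mathcal{C}$ is a functorial factorization $f=R(f)\circ L(f)$ (with $L(f):X\to E(f)$, $R(f):E(f)\to Y$ for $f:X\to Y$, functorial in commutative squares), such that $R$, regarded as an endofunctor of the slice $\mathcal{C}/Y$ (or of $\mathcal{C}^{\to}$) pointed by $L$, carries a multiplication making it a monad, and $L$, regarded as an endofunctor of $X/\mathcal{C}$ copointed by $R$, carries a comultiplication making it a comonad. $\mathsf{R}$-algebras are algebras for this monad $R$. *)

(* Defs.v *)
(* MathComp (boot) world.  Cartesian cubical sets as presheaves on B^op,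
   i.e. covariant functors B -> Type; algebraic weak factorization systems;
   uniform Kan fibration structures. *)
From Stdlib Require Import FunctionalExtensionality ProofIrrelevance.
From mathcomp Require Import all_boot.

Set Implicit Arguments.
Unset Strict Implicit.
Unset Printing Implicit Defensive.

(* [n] = {bot, x_1, ..., x_n, top} is 'I_(n.+2): bot = 0, x_i = i, top = n+1. *)
Definition bot (n : nat) : 'I_(n.+2) := ord0.
Definition top (n : nat) : 'I_(n.+2) := ord_max.

Definition Bmor (m n : nat) :=
  { f : 'I_(m.+2) -> 'I_(n.+2) | (f (bot m) == bot n) && (f (top m) == top n) }.

Definition Bfun m n (f : Bmor m n) : 'I_(m.+2) -> 'I_(n.+2) := proj1_sig f.

Lemma Bcomp_proof m n p (g : Bmor n p) (f : Bmor m n) :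
  (Bfun g (Bfun f (bot m)) == bot p) && (Bfun g (Bfun f (top m)) == top p).
Proof.
case: f => f /= /andP[/eqP -> /eqP ->]; case: g => g /= /andP[-> ->]; done.
Qed.

Definition Bcomp m n p (g : Bmor n p) (f : Bmor m n) : Bmor m p :=
  exist _ (fun i => Bfun g (Bfun f i)) (Bcomp_proof g f).

Definition Bid n : Bmor n n := exist _ (fun i => i) (introT andP (conj (eqxx _) (eqxx _))).

Lemma Bmor_ext m n (f g : Bmor m n) : Bfun f =1 Bfun g -> f = g.
Proof.
case: f g => f pf [g pg] /= H.
have E : f = g by apply: functional_extensionality.
subst; congr exist; exact: bool_irrelevance.
Qed.

Record cSet := CSet {
  ob :> nat -> Type;
  act : forall m n, Bmor m n -> ob m -> ob n;
  act_id : forall n (x : ob n), act (Bid n) x = x;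
  act_comp : forall m n p (f : Bmor m n) (g : Bmor n p) (x : ob m),
      act (Bcomp g f) x = act g (act f x)
}.
Arguments act {c m n}.

Unset Implicit Arguments.
Record hom (X Y : cSet) := Hom {
  cmp :> forall n, X n -> Y n;
  natural : forall m n (f : Bmor m n) (x : X m), cmp n (act f x) = act f (cmp m x)
}.

Set Implicit Arguments.
Arguments cmp {X Y}.
Arguments Hom {X Y}.

Lemma comp_natural (X Y Z : cSet) (g : hom Y Z) (f : hom X Y) m n (a : Bmor m n) (x : X m) :
  g n (f n (act a x)) = act a (g m (f m x)).
Proof. by rewrite natural natural. Qed.

Definition hcomp (X Y Z : cSet) (g : hom Y Z) (f : hom X Y) : hom X Z :=
  @Hom X Z (fun n x => g n (f n x)) (@comp_natural X Y Z g f).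

Definition idh (X : cSet) : hom X X := @Hom X X (fun n x => x) (fun _ _ _ _ => erefl).

Lemma cube_id n m (g : Bmor n m) : Bcomp (Bid m) g = g.
Proof. exact: Bmor_ext. Qed.
Lemma cube_comp n m p q (f : Bmor m p) (h : Bmor p q) (g : Bmor n m) :
  Bcomp (Bcomp h f) g = Bcomp h (Bcomp f g).
Proof. exact: Bmor_ext. Qed.

Definition cube (n : nat) : cSet :=
  @CSet (fun m => Bmor n m) (fun m p f g => Bcomp f g)
        (@cube_id n) (fun m p q f h g => cube_comp f h g).

Lemma prodP_id (X Y : cSet) n (x : X n * Y n) : (act (Bid n) x.1, act (Bid n) x.2) = x.
Proof. by case: x => a b /=; rewrite !act_id. Qed.
Lemma prodP_comp (X Y : cSet) m n p (f : Bmor m n) (g : Bmor n p) (x : X m * Y m) :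
  (act (Bcomp g f) x.1, act (Bcomp g f) x.2) = (act g (act f x.1), act g (act f x.2)).
Proof. by rewrite /= !act_comp. Qed.

Definition prodP (X Y : cSet) : cSet :=
  @CSet (fun n => (X n * Y n)%type) (fun m n f x => (act f x.1, act f x.2))
        (@prodP_id X Y) (@prodP_comp X Y).

Lemma prod_map_natural (A A' B B' : cSet) (a : hom A A') (b : hom B B') m n (f : Bmor m n)
  (x : prodP A B m) :
  (a n (act f x).1, b n (act f x).2) = @act (prodP A' B') m n f (a m x.1, b m x.2).
Proof. by rewrite /= !natural. Qed.

Definition prod_map (A A' B B' : cSet) (a : hom A A') (b : hom B B') :
  hom (prodP A B) (prodP A' B') :=
  @Hom (prodP A B) (prodP A' B') (fun n x => (a n x.1, b n x.2)) (@prod_map_natural A A' B B' a b).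

Definition endpt (m : nat) (d : bool) : 'I_(m.+2) := if d then top m else bot m.

(* g : [n] -> [m] lies in the image of the face alpha_i^d iff g(x_i) = d.
   The open box ⊔^n_e is the union of the images of the faces alpha_i^d with
   1 <= i <= n, (i,d) <> (1,e). *)
Definition inbox (n : nat) (e : bool) m (g : Bmor n m) : bool :=
  [exists i : 'I_(n.+2), [exists d : bool,
     [&& 0 < (i : nat) <= n, ((i : nat), d) != (1, e) & Bfun g i == endpt m d]]].

Lemma endpt_pres m p (f : Bmor m p) d : Bfun f (endpt m d) = endpt p d.
Proof. by case: f => f /= /andP[/eqP H1 /eqP H2]; case: d. Qed.

Lemma inbox_act n e m p (f : Bmor m p) (g : Bmor n m) :
  inbox e g -> inbox e (Bcomp f g).
Proof.
case/existsP=> i /existsP[d /and3P[H1 H2 /eqP H3]].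
apply/existsP; exists i; apply/existsP; exists d.
by rewrite H1 H2 /= H3 endpt_pres.
Qed.

Definition box_act n e m p (f : Bmor m p) (g : {g : Bmor n m | inbox e g}) :
  {g : Bmor n p | inbox e g} :=
  exist _ (Bcomp f (proj1_sig g)) (inbox_act f (proj2_sig g)).

Lemma box_id n e m (g : {g : Bmor n m | inbox e g}) : box_act (Bid m) g = g.
Proof.
case: g => g pg; rewrite /box_act /=.
move: (inbox_act _ _); rewrite cube_id => q; congr exist; exact: bool_irrelevance.
Qed.

Lemma box_comp n e m p q (f : Bmor m p) (h : Bmor p q) (g : {g : Bmor n m | inbox e g}) :
  box_act (Bcomp h f) g = box_act h (box_act f g).
Proof.
case: g => g pg; rewrite /box_act /=.
move: (inbox_act _ _) (inbox_act _ _); rewrite cube_comp => q1 q2.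
congr exist; exact: bool_irrelevance.
Qed.

Definition box (n : nat) (e : bool) : cSet :=
  @CSet (fun m => {g : Bmor n m | inbox e g}) (@box_act n e)
        (@box_id n e) (@box_comp n e).

Definition box_incl (n : nat) (e : bool) : hom (box n e) (cube n) :=
  @Hom (box n e) (cube n) (fun m g => proj1_sig g) (fun _ _ _ _ => erefl).

(* lifting problems are indexed by n >= 1, k >= 1, written n.+1 and k.+1;
   maps alpha : I^j -> I^k with j >= 1 are written with j.+1. *)
Record UKF (Y X : cSet) (f : hom Y X) := {
  fill : forall (n k : nat) (e : bool)
           (a : hom (prodP (cube k.+1) (cube n.+1)) X)
           (b : hom (prodP (cube k.+1) (box n.+1 e)) Y),
           hcomp f b = hcomp a (prod_map (idh _) (box_incl n.+1 e)) ->
           hom (prodP (cube k.+1) (cube n.+1)) Y;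
  fill_box : forall n k e a b (h : _),
      hcomp (@fill n k e a b h) (prod_map (idh _) (box_incl n.+1 e)) = b;
  fill_base : forall n k e a b (h : _), hcomp f (@fill n k e a b h) = a;
  fill_uniform : forall n k e a b (h : _) (j : nat) (alpha : hom (cube j.+1) (cube k.+1))
      (h' : hcomp f (hcomp b (prod_map alpha (idh _)))
            = hcomp (hcomp a (prod_map alpha (idh _))) (prod_map (idh _) (box_incl n.+1 e))),
      hcomp (@fill n k e a b h) (prod_map alpha (idh _))
      = @fill n j e (hcomp a (prod_map alpha (idh _))) (hcomp b (prod_map alpha (idh _))) h'
}.

Definition UKF_mor (Y X Y' X' : cSet) (f : hom Y X) (g : hom Y' X')
  (u : hom Y Y') (v : hom X X') (s : UKF f) (t : UKF g) : Prop :=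
  forall n k e a b (h : _)
    (h' : hcomp g (hcomp u b)
          = hcomp (hcomp v a) (prod_map (idh _) (box_incl n.+1 e))),
    hcomp u (@fill _ _ _ s n k e a b h) = @fill _ _ _ t n k e (hcomp v a) (hcomp u b) h'.

Record FunFact := {
  E : forall (X Y : cSet), hom X Y -> cSet;
  L : forall (X Y : cSet) (f : hom X Y), hom X (E f);
  R : forall (X Y : cSet) (f : hom X Y), hom (E f) Y;
  RL : forall X Y (f : hom X Y), hcomp (R f) (L f) = f;
  Emap : forall (X Y X' Y' : cSet) (f : hom X Y) (g : hom X' Y')
           (u : hom X X') (v : hom Y Y'), hcomp v f = hcomp g u -> hom (E f) (E g);
  Emap_L : forall X Y X' Y' f g u v (h : _),
      hcomp (@Emap X Y X' Y' f g u v h) (L f) = hcomp (L g) u;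
  Emap_R : forall X Y X' Y' f g u v (h : _),
      hcomp (R g) (@Emap X Y X' Y' f g u v h) = hcomp v (R f);
  Emap_id : forall X Y (f : hom X Y) (h : hcomp (idh Y) f = hcomp f (idh X)),
      Emap h = idh (E f);
  Emap_comp : forall X Y X' Y' X'' Y'' (f : hom X Y) (g : hom X' Y') (k : hom X'' Y'')
      u v u' v' (h1 : hcomp v f = hcomp g u) (h2 : hcomp v' g = hcomp k u')
      (h3 : hcomp (hcomp v' v) f = hcomp k (hcomp u' u)),
      Emap h3 = hcomp (Emap h2) (Emap h1)
}.

Record AWFS := {
  ff :> FunFact;
  (* monad structure on R (endofunctor of cSet^->, unit (L f, 1) : f -> R f) *)
  mu : forall (X Y : cSet) (f : hom X Y), hom (E ff (R ff f)) (E ff f);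
  mu_R : forall X Y (f : hom X Y), hcomp (R ff f) (mu f) = R ff (R ff f);
  mu_unit1 : forall X Y (f : hom X Y), hcomp (mu f) (L ff (R ff f)) = idh _;
  mu_unit2 : forall X Y (f : hom X Y) (h : hcomp (idh Y) f = hcomp (R ff f) (L ff f)),
      hcomp (mu f) (Emap ff h) = idh _;
  mu_assoc : forall X Y (f : hom X Y)
      (h : hcomp (idh Y) (R ff (R ff f)) = hcomp (R ff f) (mu f)),
      hcomp (mu f) (mu (R ff f)) = hcomp (mu f) (Emap ff h);
  mu_nat : forall X Y X' Y' (f : hom X Y) (g : hom X' Y') u v (h : hcomp v f = hcomp g u)
      (h' : hcomp v (R ff f) = hcomp (R ff g) (Emap ff h)),
      hcomp (Emap ff h) (mu f) = hcomp (mu g) (Emap ff h');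
  (* comonad structure on L (endofunctor of cSet^->, counit (1, R f) : L f -> f) *)
  delta : forall (X Y : cSet) (f : hom X Y), hom (E ff f) (E ff (L ff f));
  delta_L : forall X Y (f : hom X Y), hcomp (delta f) (L ff f) = L ff (L ff f);
  delta_counit1 : forall X Y (f : hom X Y), hcomp (R ff (L ff f)) (delta f) = idh _;
  delta_counit2 : forall X Y (f : hom X Y) (h : hcomp (R ff f) (L ff f) = hcomp f (idh X)),
      hcomp (Emap ff h) (delta f) = idh _;
  delta_coassoc : forall X Y (f : hom X Y)
      (h : hcomp (delta f) (L ff f) = hcomp (L ff (L ff f)) (idh X)),
      hcomp (delta (L ff f)) (delta f) = hcomp (Emap ff h) (delta f);
  delta_nat : forall X Y X' Y' (f : hom X Y) (g : hom X' Y') u v (h : hcomp v f = hcomp g u)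
      (h' : hcomp (Emap ff h) (L ff f) = hcomp (L ff g) u),
      hcomp (Emap ff h') (delta f) = hcomp (delta g) (Emap ff h)
}.

(* R-algebra structures on f : X -> Y: squares (s, 1) : R f -> f *)
Record RAlg (W : AWFS) (X Y : cSet) (f : hom X Y) := {
  alg : hom (E W f) X;
  alg_R : hcomp f alg = R W f;
  alg_unit : hcomp alg (L W f) = idh X;
  alg_assoc : forall (h : hcomp (idh Y) (R W f) = hcomp f alg),
      hcomp alg (mu W f) = hcomp alg (Emap W h)
}.

Definition RAlg_mor (W : AWFS) (X Y X' Y' : cSet) (f : hom X Y) (g : hom X' Y')
  (u : hom X X') (v : hom Y Y') (h : hcomp v f = hcomp g u) (s : RAlg W f) (t : RAlg W g) : Prop :=
  hcomp u (alg s) = hcomp (alg t) (Emap W h).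

(* Main.v *)
(* The middle object [Ef f] of the factorization of [f : X -> Y] is the free
   uniform Kan fibration over [Y] generated by [f]: its cubes are terms built
   from cubes of [X] by formally filling open boxes lying over cylinders in [Y],
   modulo the equations of a uniform filler (a filler restricts to its box, and
   commutes with reparametrisation of the parameter cube).  [Rf f] reads off the
   base and [Lf f] includes [X]; substituting terms into terms gives the
   multiplication, and recording at each formal filler its own class as its new
   base gives the comultiplication.  An R-algebra is a retraction of [Lf f] over
   [Y], so it transports the formal fillers of [Rf f] to fillers of [f];
   conversely a uniform filling structure evaluates terms.  The two constructions
   are inverse because both are determined by their values on formal fillers of
   boxes in [X]. *)

From Stdlib Require Import FunctionalExtensionality ProofIrrelevance.
From Stdlib Require Import ClassicalEpsilon PropExtensionality.
Require Import Defs.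
From mathcomp Require Import all_boot.

Set Implicit Arguments.
Unset Strict Implicit.
Unset Printing Implicit Defensive.

Lemma hom_ext (A B : cSet) (F G : hom A B) : (forall n x, F n x = G n x) -> F = G.
Proof.
case: F G => F HF [G HG] /= H.
have E : F = G.
  by apply: functional_extensionality_dep => n; apply: functional_extensionality.
by subst; congr Hom; apply: proof_irrelevance.
Qed.

Lemma congr_hom (A B : cSet) (F G : hom A B) n (x : A n) : F = G -> F n x = G n x.
Proof. by move->. Qed.

Lemma hcompE (A B C : cSet) (g : hom B C) (f : hom A B) m (x : A m) :
  hcomp g f m x = g m (f m x).
Proof. by []. Qed.

Lemma idhE (A : cSet) m (x : A m) : idh A m x = x.
Proof. by []. Qed.

Lemma hcompA (A B C D : cSet) (h1 : hom C D) (h2 : hom B C) (h3 : hom A B) :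
  hcomp (hcomp h1 h2) h3 = hcomp h1 (hcomp h2 h3).
Proof. exact: hom_ext. Qed.

Lemma hcomp1h (A B : cSet) (h : hom A B) : hcomp (idh B) h = h.
Proof. exact: hom_ext. Qed.

Lemma hcomph1 (A B : cSet) (h : hom A B) : hcomp h (idh A) = h.
Proof. exact: hom_ext. Qed.

Definition pcube k n := prodP (cube k.+1) (cube n.+1).
Definition pbox k n e := prodP (cube k.+1) (box n.+1 e).
Definition pbox_incl k n e : hom (pbox k n e) (pcube k n) := prod_map (idh _) (box_incl n.+1 e).
Definition pcube_map j k n (al : hom (cube j.+1) (cube k.+1)) : hom (pcube j n) (pcube k n) :=
  prod_map al (idh _).
Definition pbox_map j k n e (al : hom (cube j.+1) (cube k.+1)) : hom (pbox j n e) (pbox k n e) :=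
  prod_map al (idh _).

Lemma fill_congr (Y X : cSet) (f : hom Y X) (U : UKF f) n k e a a' b b' h h' :
  a = a' -> b = b' -> @fill _ _ f U n k e a b h = @fill _ _ f U n k e a' b' h'.
Proof. by move=> Ea Eb; subst; congr fill; apply: proof_irrelevance. Qed.

Lemma UKF_ext (Y X : cSet) (f : hom Y X) (U V : UKF f) :
  (forall n k e a b h, @fill _ _ f U n k e a b h = @fill _ _ f V n k e a b h) -> U = V.
Proof.
case: U V => [F1 B1 S1 U1] [F2 B2 S2 U2] /= H.
have E : F1 = F2 by do 6 (apply: functional_extensionality_dep => ?); exact: H.
by subst; congr Build_UKF; apply: proof_irrelevance.
Qed.

Section UKFRetract.
Variables (X Z Y : cSet) (f : hom X Y) (g : hom Z Y) (i : hom X Z) (r : hom Z X).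
Hypotheses (gi : hcomp g i = f) (fr : hcomp f r = g) (ri : hcomp r i = idh X).
Variable U : UKF g.

Lemma retract_box_over n k e (a : hom (pcube k n) Y) (b : hom (pbox k n e) X) :
  hcomp f b = hcomp a (pbox_incl k n e) -> hcomp g (hcomp i b) = hcomp a (pbox_incl k n e).
Proof. by rewrite -hcompA gi. Qed.

Definition retract_fill n k e a b (h : hcomp f b = hcomp a (pbox_incl k n e)) :
  hom (pcube k n) X :=
  hcomp r (fill U (retract_box_over h)).

Lemma retract_fill_box n k e a b h :
  hcomp (@retract_fill n k e a b h) (pbox_incl k n e) = b.
Proof. by rewrite /retract_fill hcompA fill_box -hcompA ri hcomp1h. Qed.

Lemma retract_fill_base n k e a b h : hcomp f (@retract_fill n k e a b h) = a.
Proof. by rewrite /retract_fill -hcompA fr fill_base. Qed.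

Lemma retract_fill_uniform n k e a b h j (al : hom (cube j.+1) (cube k.+1)) h' :
  hcomp (@retract_fill n k e a b h) (pcube_map n al)
  = @retract_fill n j e (hcomp a (pcube_map n al)) (hcomp b (pbox_map n e al)) h'.
Proof.
have h'' : hcomp g (hcomp (hcomp i b) (pbox_map n e al))
           = hcomp (hcomp a (pcube_map n al)) (pbox_incl j n e).
  by rewrite hcompA; exact: retract_box_over h'.
rewrite /retract_fill hcompA (fill_uniform U (retract_box_over h) h'').
by congr hcomp; apply: fill_congr; rewrite ?hcompA.
Qed.

Definition retract_UKF : UKF f :=
  {| fill := retract_fill; fill_box := retract_fill_box; fill_base := retract_fill_base;
     fill_uniform := retract_fill_uniform |}.

End UKFRetract.

(* [tfill a b c] is the formal filler of the box [b] lying over the cylinder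
   [a], evaluated at [c]; the box is an arbitrary family of terms, and [wf]
   asks it to be natural up to [eqv] and to lie over [a]. *)
Section Terms.
Variables X Y : cSet.

Inductive term : nat -> Type :=
| tinj m : X m -> term m
| tfill m n k (e : bool) (a : hom (pcube k n) Y) (b : forall p, pbox k n e p -> term p)
    (c : pcube k n m) : term m.

Definition tact m p (g : Bmor m p) (t : term m) : term p :=
  match t in term m0 return Bmor m0 p -> term p with
  | tinj _ x => fun g => tinj (act g x)
  | tfill _ n k e a b c => fun g => tfill a b (act g c)
  end g.

Lemma tact_id m (t : term m) : tact (Bid m) t = t.
Proof. by case: t => *; rewrite /tact act_id. Qed.

Lemma tact_comp m p q (g : Bmor m p) (h : Bmor p q) (t : term m) :
  tact (Bcomp h g) t = tact h (tact g t).
Proof. by case: t g => * ; rewrite /tact act_comp. Qed.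

Variable f : hom X Y.

Definition tbase m (t : term m) : Y m :=
  match t with
  | tinj _ x => f _ x
  | tfill _ _ _ _ a _ c => a _ c
  end.

Lemma tbase_act m p (g : Bmor m p) (t : term m) : tbase (tact g t) = act g (tbase t).
Proof. by case: t g => *; rewrite /tact /tbase natural. Qed.

Inductive wf : forall m, term m -> Prop :=
| wf_inj m (x : X m) : wf (tinj x)
| wf_fill m n k e (a : hom (pcube k n) Y) (b : forall p, pbox k n e p -> term p) (c : pcube k n m) :
   (forall p z, wf (b p z)) ->
   (forall p z, tbase (b p z) = a p (pbox_incl k n e p z)) ->
   (forall p q (g : Bmor p q) z, eqv (b q (act g z)) (tact g (b p z))) ->
   wf (@tfill m n k e a b c)
with eqv : forall m, term m -> term m -> Prop :=
| eqv_refl m (t : term m) : wf t -> eqv t t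
| eqv_sym m (t t' : term m) : eqv t t' -> eqv t' t
| eqv_trans m (t1 t2 t3 : term m) : eqv t1 t2 -> eqv t2 t3 -> eqv t1 t3
| eqv_cong m n k e (a : hom (pcube k n) Y) (b b' : forall p, pbox k n e p -> term p)
    (c : pcube k n m) :
    wf (@tfill m n k e a b c) -> wf (tfill a b' c) ->
    (forall p z, eqv (b p z) (b' p z)) -> eqv (tfill a b c) (tfill a b' c)
| eqv_box m n k e (a : hom (pcube k n) Y) (b : forall p, pbox k n e p -> term p)
    (z : pbox k n e m) :
    wf (tfill a b (pbox_incl k n e m z)) -> eqv (tfill a b (pbox_incl k n e m z)) (b m z)
| eqv_unif m n k j e (a : hom (pcube k n) Y) (b : forall p, pbox k n e p -> term p)
    (al : hom (cube j.+1) (cube k.+1)) (c : pcube j n m) :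
    wf (tfill a b (pcube_map n al m c)) ->
    eqv (tfill a b (pcube_map n al m c))
        (tfill (hcomp a (pcube_map n al)) (fun p z => b p (pbox_map n e al p z)) c).

Scheme wf_mut := Induction for wf Sort Prop
with eqv_mut := Induction for eqv Sort Prop.
Combined Scheme wf_eqv_mut from wf_mut, eqv_mut.

Definition wf_box n k e (a : hom (pcube k n) Y) (b : forall p, pbox k n e p -> term p) : Prop :=
  [/\ (forall p z, wf (b p z)),
      (forall p z, tbase (b p z) = a p (pbox_incl k n e p z)) &
      (forall p q (g : Bmor p q) z, eqv (b q (act g z)) (tact g (b p z)))].

Lemma wf_fillP m n k e a b c : wf (@tfill m n k e a b c) <-> wf_box a b.
Proof.
split; last by case; apply: wf_fill.
pose wf_head m (t : term m) :=
  if t is tfill _ _ _ _ a b _ then wf_box a b else True.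
by move=> w; have: wf_head _ (tfill a b c) by case: w => //; split.
Qed.

Lemma wf_act m p (g : Bmor m p) (t : term m) : wf t -> wf (tact g t).
Proof.
case: t g => [m' x|m' n k e a b c] g w; first exact: wf_inj.
by apply/wf_fillP; move/wf_fillP: w.
Qed.

Lemma eqv_wf m (t t' : term m) : eqv t t' -> wf t /\ wf t'.
Proof.
elim=> {m t t'} //.
- by move=> m t t' _ [].
- by move=> m t1 t2 t3 _ [] ? _ _ [].
- by move=> m n k e a b z w; split=> //; case/wf_fillP: w.
- move=> m n k j e a b al c w; split=> //.
  case/wf_fillP: w => wb bb eb; apply/wf_fillP; split=> // p q g z.
  by move: (eb _ _ g (pbox_map n e al p z)); rewrite -natural.
Qed.

Lemma eqv_act m p (g : Bmor m p) (t t' : term m) : eqv t t' -> eqv (tact g t) (tact g t').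
Proof.
move=> H; elim: H p g => {m t t'}.
- by move=> m t w p g; apply/eqv_refl/wf_act.
- by move=> m t t' _ IH p g; apply: eqv_sym.
- by move=> m t1 t2 t3 _ IH1 _ IH2 p g; apply: eqv_trans (IH1 p g) (IH2 p g).
- move=> m n k e a b b' c w w' H _ p g.
  by apply: eqv_cong => //; apply/wf_fillP; [case/wf_fillP: w | case/wf_fillP: w'].
- move=> m n k e a b z w p g.
  have -> : tact g (tfill a b (pbox_incl k n e m z)) = tfill a b (pbox_incl k n e p (act g z)).
    by [].
  case/wf_fillP: (w) => _ _ eb; apply: eqv_trans (eb _ _ _ _).
  by apply/eqv_box/wf_fillP; case/wf_fillP: w.
- move=> m n k j e a b al c w p g.
  have E : act g (pcube_map n al m c) = pcube_map n al p (act g c) by rewrite natural.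
  have -> : tact g (tfill a b (pcube_map n al m c)) = tfill a b (pcube_map n al p (act g c)).
    by rewrite -E.
  by apply/eqv_unif/wf_fillP; case/wf_fillP: w.
Qed.

Lemma tbase_eqv m (t t' : term m) : eqv t t' -> tbase t = tbase t'.
Proof.
elim=> {m t t'} //.
- by move=> m t1 t2 t3 _ -> _ ->.
- by move=> m n k e a b z /wf_fillP[_ bb _] /=; rewrite bb.
Qed.

End Terms.

Arguments wf_fillP {X Y f m n k e a b c}.

Section PerQuotient.
Variables (A : Type) (R : A -> A -> Prop).
Hypotheses (R_sym : forall x y, R x y -> R y x)
           (R_trans : forall x y z, R x y -> R y z -> R x z).

Definition per_quot := {S : A -> Prop | exists t, R t t /\ S = R t}.

Definition pclass t (w : R t t) : per_quot := exist _ (R t) (ex_intro _ t (conj w erefl)).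

Definition prepr (q : per_quot) : A :=
  proj1_sig (constructive_indefinite_description _ (proj2_sig q)).

Lemma prepr_spec q : R (prepr q) (prepr q) /\ proj1_sig q = R (prepr q).
Proof. by rewrite /prepr; case: constructive_indefinite_description. Qed.

Lemma prepr_refl q : R (prepr q) (prepr q).
Proof. by case: (prepr_spec q). Qed.

Lemma per_quot_ext (q q' : per_quot) : proj1_sig q = proj1_sig q' -> q = q'.
Proof. by case: q q' => S HS [S' HS'] /= E; subst; congr exist; apply: proof_irrelevance. Qed.

Lemma pclass_prepr q (w : R (prepr q) (prepr q)) : pclass w = q.
Proof. by apply: per_quot_ext; case: (prepr_spec q). Qed.

Lemma pclass_eq t t' (w : R t t) (w' : R t' t') : R t t' -> pclass w = pclass w'.
Proof.
move=> H; apply: per_quot_ext => /=.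
apply: functional_extensionality => x; apply: propositional_extensionality.
by split; [apply: R_trans (R_sym H) | apply: R_trans H].
Qed.

Lemma prepr_pclass t (w : R t t) : R (prepr (pclass w)) t.
Proof. by have [_ /= <-] := prepr_spec (pclass w). Qed.

End PerQuotient.

Section FreeFactorization.
Variables (X Y : cSet) (f : hom X Y).

Notation wf := (@wf X Y f).
Notation eqv := (@eqv X Y f).

Definition eclass m (t : term X Y m) (w : wf t) : per_quot (@eqv m) := pclass (eqv_refl w).
Definition erepr m (q : per_quot (@eqv m)) : term X Y m := prepr q.

Lemma wf_erepr m (q : per_quot (@eqv m)) : wf (erepr q).
Proof. by case: (eqv_wf (prepr_refl q)). Qed.

Lemma eclass_eq m (t t' : term X Y m) (w : wf t) (w' : wf t') : eqv t t' -> eclass w = eclass w'.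
Proof. exact/pclass_eq/eqv_trans/eqv_sym. Qed.

Lemma eclass_erepr m (q : per_quot (@eqv m)) (w : wf (erepr q)) : eclass w = q.
Proof. exact: pclass_prepr. Qed.

Lemma erepr_eclass m (t : term X Y m) (w : wf t) : eqv (erepr (eclass w)) t.
Proof. exact: prepr_pclass. Qed.

Lemma eclass_ind (P : forall m, per_quot (@eqv m) -> Prop) :
  (forall m (t : term X Y m) (w : wf t), P m (eclass w)) -> forall m q, P m q.
Proof. by move=> H m q; rewrite -(eclass_erepr (wf_erepr q)). Qed.

Definition Eact m p (g : Bmor m p) (q : per_quot (@eqv m)) : per_quot (@eqv p) :=
  eclass (wf_act g (wf_erepr q)).

Lemma Eact_id m (q : per_quot (@eqv m)) : Eact (Bid m) q = q.
Proof.
rewrite /Eact -[RHS](eclass_erepr (wf_erepr q)); apply: eclass_eq.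
by rewrite tact_id; apply/eqv_refl/wf_erepr.
Qed.

Lemma Eact_comp m n p (g : Bmor m n) (h : Bmor n p) (q : per_quot (@eqv m)) :
  Eact (Bcomp h g) q = Eact h (Eact g q).
Proof.
rewrite /Eact; apply: eclass_eq; rewrite tact_comp.
by apply/eqv_act/eqv_sym/erepr_eclass.
Qed.

Definition Ef : cSet := @CSet (fun m => per_quot (@eqv m)) Eact Eact_id Eact_comp.

Lemma Ef_hom_ext (Z : cSet) (F G : hom Ef Z) :
  (forall m (t : term X Y m) (w : wf t), F m (eclass w) = G m (eclass w)) -> F = G.
Proof. by move=> H; apply: hom_ext; apply: eclass_ind. Qed.

Lemma Ef_act_class m p (g : Bmor m p) (t : term X Y m) (w : wf t) (w' : wf (tact g t)) :
  @act Ef m p g (eclass w) = eclass w'.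
Proof. by apply/eclass_eq/eqv_act/erepr_eclass. Qed.

Lemma Lf_natural m n (g : Bmor m n) (x : X m) :
  eclass (wf_inj f (act g x)) = @act Ef m n g (eclass (wf_inj f x)).
Proof. exact/esym/Ef_act_class. Qed.

Definition Lf : hom X Ef := @Hom X Ef (fun m x => eclass (wf_inj f x)) Lf_natural.

Lemma Rf_natural m n (g : Bmor m n) (q : Ef m) :
  tbase f (erepr (act g q)) = act g (tbase f (erepr q)).
Proof. by rewrite -tbase_act; apply/tbase_eqv/erepr_eclass. Qed.

Definition Rf : hom Ef Y := @Hom Ef Y (fun m q => tbase f (erepr q)) Rf_natural.

Lemma Rf_class m (t : term X Y m) (w : wf t) : Rf m (eclass w) = tbase f t.
Proof. exact/tbase_eqv/erepr_eclass. Qed.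

Lemma Rf_Lf : hcomp Rf Lf = f.
Proof. by apply: hom_ext => m x; apply: Rf_class. Qed.

Section FillClass.
Variables (n k : nat) (e : bool) (a : hom (pcube k n) Y).
Variables (b : forall p, pbox k n e p -> term X Y p) (wb : wf_box f a b).

Definition wf_fill_box m (c : pcube k n m) : wf (tfill a b c) := proj2 wf_fillP wb.

Lemma fill_class_natural m p (g : Bmor m p) (c : pcube k n m) :
  eclass (wf_fill_box (act g c)) = @act Ef m p g (eclass (wf_fill_box c)).
Proof. exact/esym/Ef_act_class. Qed.

Definition fill_class : hom (pcube k n) Ef :=
  @Hom (pcube k n) Ef (fun m c => eclass (wf_fill_box c)) fill_class_natural.

Lemma Rf_fill_class : hcomp Rf fill_class = a.
Proof. by apply: hom_ext => m c; apply: Rf_class. Qed.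

Lemma fill_class_box m (z : pbox k n e m) (w : wf (b z)) :
  fill_class m (pbox_incl k n e m z) = eclass w.
Proof. by apply/eclass_eq/eqv_box/wf_fillP. Qed.

Lemma wf_box_term p (z : pbox k n e p) : wf (b z).
Proof. by case: wb. Qed.

Lemma box_class_natural p q (g : Bmor p q) (z : pbox k n e p) :
  eclass (wf_box_term (act g z)) = @act Ef p q g (eclass (wf_box_term z)).
Proof. by rewrite (Ef_act_class _ (wf_act g (wf_box_term z))); apply: eclass_eq; case: wb. Qed.

Definition box_class : hom (pbox k n e) Ef :=
  @Hom (pbox k n e) Ef (fun p z => eclass (wf_box_term z)) box_class_natural.

Lemma Rf_box_class : hcomp Rf box_class = hcomp a (pbox_incl k n e).
Proof. by apply: hom_ext => p z; rewrite hcompE Rf_class; case: wb. Qed.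

End FillClass.

Lemma fill_class_eq n k e a a' b b' (wb : wf_box f a b) (wb' : wf_box f a' b') :
  (forall m (c : pcube k n m), eqv (tfill a b c) (tfill a' b' c)) ->
  @fill_class n k e a b wb = @fill_class n k e a' b' wb'.
Proof. by move=> H; apply: hom_ext => m c; apply/eclass_eq/H. Qed.

Lemma fill_class_uniform n k j e a b (wb : wf_box f a b) (al : hom (cube j.+1) (cube k.+1)) wb' :
  hcomp (@fill_class n k e a b wb) (pcube_map n al)
  = @fill_class n j e (hcomp a (pcube_map n al)) (fun p z => b p (pbox_map n e al p z)) wb'.
Proof. by apply: hom_ext => m c; apply/eclass_eq/eqv_unif/wf_fillP. Qed.

Section FreeFill.
Variables (n k : nat) (e : bool) (a : hom (pcube k n) Y) (B : hom (pbox k n e) Ef).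
Hypothesis B_over : hcomp Rf B = hcomp a (pbox_incl k n e).

Lemma wf_box_erepr : wf_box f a (fun p z => erepr (B p z)).
Proof.
split=> [p z|p z|p q g z]; first exact: wf_erepr.
- exact: (congr_hom z B_over).
- rewrite natural -{1}(eclass_erepr (wf_erepr (B p z))) (Ef_act_class _ (wf_act g (wf_erepr _))).
  exact: erepr_eclass.
Qed.

Definition free_fill : hom (pcube k n) Ef := fill_class wf_box_erepr.

Lemma free_fill_box : hcomp free_fill (pbox_incl k n e) = B.
Proof.
by apply: hom_ext => m z; apply: etrans (fill_class_box _ (wf_erepr _)) (eclass_erepr _).
Qed.

End FreeFill.

Lemma free_fill_uniform n k e a B h j (al : hom (cube j.+1) (cube k.+1)) h' :
  hcomp (@free_fill n k e a B h) (pcube_map n al)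
  = @free_fill n j e (hcomp a (pcube_map n al)) (hcomp B (pbox_map n e al)) h'.
Proof. exact: fill_class_uniform. Qed.

Definition Rf_UKF : UKF Rf :=
  {| fill := free_fill; fill_box := free_fill_box;
     fill_base := fun n k e a B h => Rf_fill_class _;
     fill_uniform := free_fill_uniform |}.

End FreeFactorization.

Section Bind.
Variables (X Y X' Y' : cSet) (sub : forall m, X m -> term X' Y' m) (v : hom Y Y').

Fixpoint tbind m (t : term X Y m) : term X' Y' m :=
  match t with
  | tinj _ x => sub x
  | tfill _ n k e a b c => tfill (hcomp v a) (fun p z => tbind (b p z)) c
  end.

Lemma tbind_fill m n k e a b c :
  tbind (@tfill X Y m n k e a b c) = tfill (hcomp v a) (fun p z => tbind (b p z)) c.
Proof. by []. Qed.

Variables (f : hom X Y) (f' : hom X' Y').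
Hypotheses (wf_sub : forall m (x : X m), wf f' (sub x))
  (sub_act : forall m p (g : Bmor m p) (x : X m), eqv f' (sub (act g x)) (tact g (sub x)))
  (tbase_sub : forall m (x : X m), tbase f' (sub x) = v m (f m x)).

Lemma tbase_bind m (t : term X Y m) : tbase f' (tbind t) = v m (tbase f t).
Proof. by case: t => [m' x|*]; first exact: tbase_sub. Qed.

Lemma bind_wf_eqv :
  (forall m t, wf f t -> wf f' (@tbind m t) /\
     forall p (g : Bmor m p), eqv f' (tbind (tact g t)) (tact g (tbind t))) /\
  (forall m t t', eqv f t t' -> eqv f' (@tbind m t) (tbind t')).
Proof.
apply: (wf_eqv_mut
  (P := fun m t _ => wf f' (@tbind m t) /\
          forall p (g : Bmor m p), eqv f' (tbind (tact g t)) (tact g (tbind t)))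
  (P0 := fun m t t' _ => eqv f' (@tbind m t) (tbind t'))).
- by move=> m x; split=> [|p g]; [exact: wf_sub | exact: sub_act].
- move=> m n k e a b c _ IHw bb _ IHe.
  have w : wf f' (tbind (tfill a b c)).
    apply/wf_fillP; split=> [p z|p z|p q g z]; first by case: (IHw p z).
    + by rewrite tbase_bind bb.
    + by apply: eqv_trans (IHe p q g z) _; case: (IHw p z).
  by split=> // p g; apply: eqv_refl; exact: (wf_act g w).
- by move=> m t _ [w _]; apply: eqv_refl.
- by move=> m t t' _; apply: eqv_sym.
- by move=> m t1 t2 t3 _ IH1 _ IH2; apply: eqv_trans IH1 IH2.
- by move=> m n k e a b b' c _ [w _] _ [w' _] _ IH; apply: eqv_cong.
- by move=> m n k e a b z _ [w _]; apply: eqv_box.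
- by move=> m n k j e a b al c _ [w _]; rewrite !tbind_fill -hcompA; apply: eqv_unif.
Qed.

Lemma wf_bind m (t : term X Y m) : wf f t -> wf f' (tbind t).
Proof. by move=> w; case: (proj1 bind_wf_eqv m t w). Qed.

Lemma bind_act m p (g : Bmor m p) (t : term X Y m) :
  wf f t -> eqv f' (tbind (tact g t)) (tact g (tbind t)).
Proof. by move=> w; case: (proj1 bind_wf_eqv m t w). Qed.

Lemma eqv_bind m (t t' : term X Y m) : eqv f t t' -> eqv f' (tbind t) (tbind t').
Proof. exact: (proj2 bind_wf_eqv). Qed.

Lemma Ebind_natural m p (g : Bmor m p) (q : Ef f m) :
  eclass (wf_bind (wf_erepr (act g q))) = @act (Ef f') m p g (eclass (wf_bind (wf_erepr q))).
Proof.
rewrite (Ef_act_class _ (wf_act g (wf_bind (wf_erepr q)))); apply: eclass_eq.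
apply: eqv_trans (bind_act g (wf_erepr q)).
by apply/eqv_bind/erepr_eclass.
Qed.

Definition Ebind : hom (Ef f) (Ef f') :=
  @Hom (Ef f) (Ef f') (fun m q => eclass (wf_bind (wf_erepr q))) Ebind_natural.

Lemma Ebind_class m (t : term X Y m) (w : wf f t) (w' : wf f' (tbind t)) :
  Ebind m (eclass w) = eclass w'.
Proof. by apply/eclass_eq/eqv_bind/erepr_eclass. Qed.

Lemma Rf_Ebind : hcomp (Rf f') Ebind = hcomp v (Rf f).
Proof. by apply: hom_ext => m q; apply: etrans (Rf_class _) (tbase_bind _). Qed.

End Bind.

Lemma tbind_comp (X Y X' Y' X'' Y'' : cSet) (sub : forall m, X m -> term X' Y' m) (v : hom Y Y')
    (sub' : forall m, X' m -> term X'' Y'' m) (v' : hom Y' Y'') m (t : term X Y m) :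
  tbind sub' v' (tbind sub v t) = tbind (fun m x => tbind sub' v' (sub m x)) (hcomp v' v) t.
Proof.
elim: t => [m' x|m' n k e a b IH c] //=; rewrite hcompA; congr tfill.
by apply: functional_extensionality_dep => p; apply: functional_extensionality.
Qed.

Lemma tbind_tinj (X Y : cSet) m (t : term X Y m) : tbind (tinj Y) (idh Y) t = t.
Proof.
elim: t => [m' x|m' n k e a b IH c] //=; rewrite hcomp1h; congr tfill.
by apply: functional_extensionality_dep => p; apply: functional_extensionality.
Qed.

Lemma eqv_bind_sub (X Y X' Y' : cSet) (f' : hom X' Y') (sub sub' : forall m, X m -> term X' Y' m)
    (v : hom Y Y') m (t : term X Y m) :
  (forall m x, eqv f' (sub m x) (sub' m x)) ->
  wf f' (tbind sub v t) -> wf f' (tbind sub' v t) -> eqv f' (tbind sub v t) (tbind sub' v t).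
Proof.
move=> Hsub; elim: t => [m' x|m' n k e a b IH c] //= w w'.
apply: eqv_cong => // p z.
by apply: IH; [case/wf_fillP: w | case/wf_fillP: w'].
Qed.

Definition tmap (X Y X' Y' : cSet) (u : hom X X') (v : hom Y Y') :=
  tbind (fun m x => tinj Y' (u m x)) v.

Section Emap.
Variables (X Y X' Y' : cSet) (f : hom X Y) (g : hom X' Y') (u : hom X X') (v : hom Y Y').
Hypothesis sq : hcomp v f = hcomp g u.

Lemma tmap_leaf_act m p (h : Bmor m p) (x : X m) :
  eqv g (tinj Y' (u p (act h x))) (tact h (tinj Y' (u m x))).
Proof. by rewrite natural; apply/eqv_refl/wf_inj. Qed.

Lemma tmap_leaf_base m (x : X m) : tbase g (tinj Y' (u m x)) = v m (f m x).
Proof. exact: (congr_hom x (esym sq)). Qed.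

Definition Emapf : hom (Ef f) (Ef g) :=
  Ebind (fun m x => wf_inj g (u m x)) tmap_leaf_act tmap_leaf_base.

Lemma wf_tmap m (t : term X Y m) : wf f t -> wf g (tmap u v t).
Proof. exact: (wf_bind (fun m x => wf_inj g (u m x)) tmap_leaf_act tmap_leaf_base). Qed.

Lemma Emapf_class m (t : term X Y m) (w : wf f t) (w' : wf g (tmap u v t)) :
  Emapf m (eclass w) = eclass w'.
Proof. exact: Ebind_class. Qed.

Lemma Emapf_L : hcomp Emapf (Lf f) = hcomp (Lf g) u.
Proof. by apply: hom_ext => m x; apply: Emapf_class. Qed.

Lemma Emapf_R : hcomp (Rf g) Emapf = hcomp v (Rf f).
Proof. exact: Rf_Ebind. Qed.

End Emap.

Lemma Emapf_id (X Y : cSet) (f : hom X Y) (h : hcomp (idh Y) f = hcomp f (idh X)) :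
  Emapf h = idh (Ef f).
Proof.
apply: Ef_hom_ext => m t w; rewrite idhE (Emapf_class h w (wf_tmap h w)).
by apply: eclass_eq; rewrite /tmap tbind_tinj; apply: eqv_refl.
Qed.

Lemma Emapf_comp (X Y X' Y' X'' Y'' : cSet) (f : hom X Y) (g : hom X' Y') (k : hom X'' Y'')
    u v u' v' (h1 : hcomp v f = hcomp g u) (h2 : hcomp v' g = hcomp k u')
    (h3 : hcomp (hcomp v' v) f = hcomp k (hcomp u' u)) :
  Emapf h3 = hcomp (Emapf h2) (Emapf h1).
Proof.
apply: Ef_hom_ext => m t w; rewrite hcompE.
rewrite (Emapf_class h1 w (wf_tmap h1 w)) (Emapf_class h2 _ (wf_tmap h2 (wf_tmap h1 w))).
rewrite (Emapf_class h3 w (wf_tmap h3 w)); apply: eclass_eq.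
by rewrite /tmap tbind_comp; exact: (eqv_refl (wf_tmap h3 w)).
Qed.

Section Join.
Variables (X Y : cSet) (f : hom X Y).

Definition tjoin := tbind (fun m (q : Ef f m) => erepr q) (idh Y).

Lemma tjoin_leaf_wf m (q : Ef f m) : wf f (erepr q).
Proof. exact: wf_erepr. Qed.

Lemma tjoin_leaf_act m p (g : Bmor m p) (q : Ef f m) : eqv f (erepr (act g q)) (tact g (erepr q)).
Proof. exact: erepr_eclass. Qed.

Lemma tjoin_leaf_base m (q : Ef f m) : tbase f (erepr q) = idh Y m (Rf f m q).
Proof. by []. Qed.

Definition muf : hom (Ef (Rf f)) (Ef f) :=
  Ebind tjoin_leaf_wf tjoin_leaf_act tjoin_leaf_base.

Lemma wf_tjoin m (t : term (Ef f) Y m) : wf (Rf f) t -> wf f (tjoin t).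
Proof. exact: (wf_bind tjoin_leaf_wf tjoin_leaf_act tjoin_leaf_base). Qed.

Lemma muf_class m (t : term (Ef f) Y m) (w : wf (Rf f) t) (w' : wf f (tjoin t)) :
  muf m (eclass w) = eclass w'.
Proof. exact: Ebind_class. Qed.

End Join.

Section JoinLaws.
Variables (X Y : cSet) (f : hom X Y).

Lemma muf_R : hcomp (Rf f) (muf f) = Rf (Rf f).
Proof. by rewrite Rf_Ebind hcomp1h. Qed.

Lemma muf_unit1 : hcomp (muf f) (Lf (Rf f)) = idh (Ef f).
Proof.
apply: hom_ext => m q; rewrite hcompE idhE.
by rewrite (muf_class (wf_inj (Rf f) q) (wf_erepr q)) eclass_erepr.
Qed.

Lemma muf_unit2 (h : hcomp (idh Y) f = hcomp (Rf f) (Lf f)) :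
  hcomp (muf f) (Emapf h) = idh (Ef f).
Proof.
apply: Ef_hom_ext => m t w; rewrite hcompE idhE.
have w' := wf_tjoin (wf_tmap h w).
rewrite (Emapf_class h w (wf_tmap h w)) (muf_class _ w'); apply: eclass_eq.
move: w'; rewrite /tjoin /tmap tbind_comp hcomp1h => w'.
have := eqv_bind_sub (sub' := tinj Y) (fun m x => erepr_eclass (wf_inj f x)) w'.
by rewrite tbind_tinj; apply.
Qed.

Lemma muf_assoc (h : hcomp (idh Y) (Rf (Rf f)) = hcomp (Rf f) (muf f)) :
  hcomp (muf f) (muf (Rf f)) = hcomp (muf f) (Emapf h).
Proof.
apply: Ef_hom_ext => m t w; rewrite !hcompE.
have w1 := wf_tjoin (wf_tjoin w); have w2 := wf_tjoin (wf_tmap h w).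
rewrite (muf_class _ (wf_tjoin w)) (muf_class _ w1) (Emapf_class h w (wf_tmap h w)).
rewrite (muf_class _ w2); apply: eclass_eq.
move: w1 w2; rewrite /tjoin /tmap !tbind_comp => w1 w2.
apply: eqv_bind_sub w1 w2 => m' q.
exact/eqv_sym/erepr_eclass.
Qed.

End JoinLaws.

Lemma muf_nat (X Y X' Y' : cSet) (f : hom X Y) (g : hom X' Y') u v (h : hcomp v f = hcomp g u)
    (h' : hcomp v (Rf f) = hcomp (Rf g) (Emapf h)) :
  hcomp (Emapf h) (muf f) = hcomp (muf g) (Emapf h').
Proof.
apply: Ef_hom_ext => m t w; rewrite !hcompE.
have w1 := wf_tmap h (wf_tjoin w); have w2 := wf_tjoin (wf_tmap h' w).
rewrite (muf_class _ (wf_tjoin w)) (Emapf_class h _ w1) (Emapf_class h' w (wf_tmap h' w)).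
rewrite (muf_class _ w2); apply: eclass_eq.
move: w1 w2; rewrite /tjoin /tmap !tbind_comp hcomp1h hcomph1 => w1 w2.
apply: eqv_bind_sub w1 w2 => m' q.
exact/eqv_sym/erepr_eclass.
Qed.

Definition vertex_fun n m (d : bool) (i : 'I_(n.+3)) : 'I_(m.+2) :=
  if (i : nat) == 0 then bot m else if (i : nat) == n.+2 then top m else endpt m d.

Lemma vertex_proof n m d :
  (vertex_fun m d (bot n.+1) == bot m) && (vertex_fun m d (top n.+1) == top m).
Proof. by rewrite /vertex_fun /= eqxx. Qed.

Definition vertex n m d : Bmor n.+1 m := exist _ (vertex_fun m d) (vertex_proof n m d).

Lemma vertex_inbox n m e : inbox e (vertex n m (~~ e)).
Proof.
apply/existsP; exists (inord 1); apply/existsP; exists (~~ e).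
by rewrite /= /vertex_fun inordK // eqxx andbT; case: e.
Qed.

(* Some cube of the open box, only used to give junk values on ill-formed boxes. *)
Definition box_point k n e m (c : pcube k n m) : pbox k n e m :=
  (c.1, exist _ (vertex n m (~~ e)) (vertex_inbox n m e)).

Section Dup.
Variables (X Y : cSet) (f : hom X Y).

Fixpoint tdup m (t : term X Y m) : term X (Ef f) m :=
  match t with
  | tinj _ x => tinj (Ef f) x
  | tfill m0 n k e a b c =>
      match excluded_middle_informative (wf_box f a b) with
      | left wb => tfill (fill_class wb) (fun p z => tdup (b p z)) c
      | right _ => tdup (b m0 (box_point e c))
      end
  end.

Lemma tdup_fill m n k e a b (c : pcube k n m) (wb : wf_box f a b) :
  tdup (@tfill _ _ m n k e a b c) = tfill (fill_class wb) (fun p z => tdup (b p z)) c.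
Proof.
rewrite /=; case: excluded_middle_informative => [wb'|] //.
by rewrite (proof_irrelevance _ wb wb').
Qed.

Lemma tdup_act m p (g : Bmor m p) (t : term X Y m) : wf f t -> tdup (tact g t) = tact g (tdup t).
Proof.
case: t g => [m0 x|m0 n k e a b c] g w //; move/wf_fillP: w => wb.
by rewrite (tdup_fill _ wb) [tact _ _]/= (tdup_fill _ wb).
Qed.

Lemma tbase_dup m (t : term X Y m) (w : wf f t) : tbase (Lf f) (tdup t) = eclass w.
Proof.
case: t w => [m0 x|m0 n k e a b c] w; first exact/eclass_eq/eqv_refl/wf_inj.
by move/wf_fillP: (w) => wb; rewrite (tdup_fill _ wb); apply/eclass_eq/eqv_refl.
Qed.

Lemma dup_wf_eqv :
  (forall m t, wf f t -> wf (Lf f) (@tdup m t)) /\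
  (forall m t t', eqv f t t' -> eqv (Lf f) (@tdup m t) (tdup t')).
Proof.
apply: (wf_eqv_mut (P := fun m t _ => wf (Lf f) (@tdup m t))
                   (P0 := fun m t t' _ => eqv (Lf f) (@tdup m t) (tdup t'))).
- by move=> m x; apply: wf_inj.
- move=> m n k e a b c w IHw bb eb IHe.
  have wb : wf_box f a b by split.
  rewrite (tdup_fill _ wb); apply/wf_fillP; split=> [p z|p z|p q g z] //.
  + by rewrite (tbase_dup (w p z)) -(fill_class_box wb (w p z)).
  + by apply: eqv_trans (IHe p q g z) _; rewrite tdup_act //; apply/eqv_refl/wf_act.
- by move=> m t _ IH; apply: eqv_refl.
- by move=> m t t' _; apply: eqv_sym.
- by move=> m t1 t2 t3 _ IH1 _ IH2; apply: eqv_trans IH1 IH2.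
- move=> m n k e a b b' c w IHw w' IHw' eb IHe.
  move: IHw IHw'; move/wf_fillP: (w) => wb; move/wf_fillP: (w') => wb'.
  rewrite (tdup_fill _ wb) (tdup_fill _ wb') (fill_class_eq wb wb') => [IHw IHw'|m' c'].
    exact: eqv_cong.
  by apply: eqv_cong => //; apply/wf_fillP.
- move=> m n k e a b z w IHw; move: IHw; move/wf_fillP: (w) => wb.
  by rewrite (tdup_fill _ wb) => IHw; apply: eqv_box.
- move=> m n k j e a b al c w IHw; have [_ w2] := eqv_wf (eqv_unif w).
  move: IHw; move/wf_fillP: (w) => wb; move/wf_fillP: (w2) => wb2.
  rewrite (tdup_fill _ wb) (tdup_fill _ wb2) -(fill_class_uniform wb wb2) => IHw.
  exact: eqv_unif.
Qed.

Lemma wf_tdup m (t : term X Y m) : wf f t -> wf (Lf f) (tdup t).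
Proof. exact: (proj1 dup_wf_eqv). Qed.

Lemma eqv_tdup m (t t' : term X Y m) : eqv f t t' -> eqv (Lf f) (tdup t) (tdup t').
Proof. exact: (proj2 dup_wf_eqv). Qed.

Lemma deltaf_natural m p (g : Bmor m p) (q : Ef f m) :
  eclass (wf_tdup (wf_erepr (act g q)))
  = @act (Ef (Lf f)) m p g (eclass (wf_tdup (wf_erepr q))).
Proof.
rewrite (Ef_act_class _ (wf_act g (wf_tdup (wf_erepr q)))); apply: eclass_eq.
rewrite -tdup_act; last exact: wf_erepr.
exact/eqv_tdup/erepr_eclass.
Qed.

Definition deltaf : hom (Ef f) (Ef (Lf f)) :=
  @Hom (Ef f) (Ef (Lf f)) (fun m q => eclass (wf_tdup (wf_erepr q))) deltaf_natural.

Lemma deltaf_class m (t : term X Y m) (w : wf f t) : deltaf m (eclass w) = eclass (wf_tdup w).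
Proof. exact/eclass_eq/eqv_tdup/erepr_eclass. Qed.

End Dup.

Section DupLaws.
Variables (X Y : cSet) (f : hom X Y).

Lemma deltaf_L : hcomp (deltaf f) (Lf f) = Lf (Lf f).
Proof.
apply: hom_ext => m x; apply: etrans (deltaf_class (wf_inj f x)) _.
exact/eclass_eq/eqv_refl/wf_inj.
Qed.

Lemma deltaf_counit1 : hcomp (Rf (Lf f)) (deltaf f) = idh (Ef f).
Proof.
apply: Ef_hom_ext => m t w; rewrite hcompE idhE deltaf_class Rf_class.
exact: tbase_dup.
Qed.

Lemma tmap_Rf_tdup (h : hcomp (Rf f) (Lf f) = hcomp f (idh X)) m (t : term X Y m) :
  wf f t -> eqv f (tmap (idh X) (Rf f) (tdup f t)) t.
Proof.
elim=> {m t} [m x|m n k e a b c w IH bb eb]; first exact/eqv_refl/wf_inj.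
have wb : wf_box f a b by split.
have wfill : wf f (tfill a b c) by apply/wf_fillP.
have := wf_tmap h (wf_tdup wfill).
rewrite (tdup_fill _ wb) /tmap tbind_fill Rf_fill_class => w'.
by apply: eqv_cong => // p z; apply: IH.
Qed.

Lemma deltaf_counit2 (h : hcomp (Rf f) (Lf f) = hcomp f (idh X)) :
  hcomp (Emapf h) (deltaf f) = idh (Ef f).
Proof.
apply: Ef_hom_ext => m t w; rewrite hcompE idhE deltaf_class.
rewrite (Emapf_class h _ (wf_tmap h (wf_tdup w))).
exact/eclass_eq/tmap_Rf_tdup.
Qed.

Lemma tdup_tdup (h : hcomp (deltaf f) (Lf f) = hcomp (Lf (Lf f)) (idh X)) m (t : term X Y m) :
  wf f t -> eqv (Lf (Lf f)) (tdup (Lf f) (tdup f t)) (tmap (idh X) (deltaf f) (tdup f t)).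
Proof.
elim=> {m t} [m x|m n k e a b c w IH bb eb]; first exact/eqv_refl/wf_inj.
have wb : wf_box f a b by split.
have wfill : wf f (tfill a b c) by apply/wf_fillP.
have wb' : wf_box (Lf f) (fill_class wb) (fun p z => tdup f (b p z)).
  by apply/(wf_fillP (c := c)); rewrite -(tdup_fill c wb); apply: wf_tdup.
have E : fill_class wb' = hcomp (deltaf f) (fill_class wb).
  apply: hom_ext => m' c'; apply/esym/(etrans (deltaf_class (wf_fill_box wb c'))).
  by apply: eclass_eq; rewrite (tdup_fill _ wb); exact: (eqv_refl (wf_fill_box wb' c')).
have := wf_tmap h (wf_tdup wfill); have := wf_tdup (wf_tdup wfill).
rewrite (tdup_fill _ wb) /tmap tbind_fill (tdup_fill _ wb') E => w1 w2.
by apply: eqv_cong => // p z; apply: IH.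
Qed.

Lemma deltaf_coassoc (h : hcomp (deltaf f) (Lf f) = hcomp (Lf (Lf f)) (idh X)) :
  hcomp (deltaf (Lf f)) (deltaf f) = hcomp (Emapf h) (deltaf f).
Proof.
apply: Ef_hom_ext => m t w; rewrite !hcompE !deltaf_class.
rewrite (Emapf_class h _ (wf_tmap h (wf_tdup w))).
exact/eclass_eq/tdup_tdup.
Qed.

End DupLaws.

Section DupNatural.
Variables (X Y X' Y' : cSet) (f : hom X Y) (g : hom X' Y') (u : hom X X') (v : hom Y Y').
Hypotheses (h : hcomp v f = hcomp g u) (h' : hcomp (Emapf h) (Lf f) = hcomp (Lf g) u).

Lemma tmap_tdup m (t : term X Y m) :
  wf f t -> eqv (Lf g) (tmap u (Emapf h) (tdup f t)) (tdup g (tmap u v t)).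
Proof.
elim=> {m t} [m x|m n k e a b c w IH bb eb]; first exact/eqv_refl/wf_inj.
have wb : wf_box f a b by split.
have wfill : wf f (tfill a b c) by apply/wf_fillP.
have wb' : wf_box g (hcomp v a) (fun p z => tmap u v (b p z)).
  by apply/(wf_fillP (c := c)); exact: (wf_tmap h wfill).
have E : hcomp (Emapf h) (fill_class wb) = fill_class wb'.
  by apply: hom_ext => m' c'; apply: Emapf_class.
have := wf_tdup (wf_tmap h wfill); have := wf_tmap h' (wf_tdup wfill).
rewrite (tdup_fill _ wb) /tmap !tbind_fill (tdup_fill _ wb') E => w1 w2.
by apply: eqv_cong => // p z; apply: IH.
Qed.

Lemma deltaf_nat : hcomp (Emapf h') (deltaf f) = hcomp (deltaf g) (Emapf h).
Proof.
apply: Ef_hom_ext => m t w; rewrite !hcompE deltaf_class (Emapf_class h w (wf_tmap h w)).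
rewrite deltaf_class (Emapf_class h' _ (wf_tmap h' (wf_tdup w))).
exact/eclass_eq/tmap_tdup.
Qed.

End DupNatural.

Definition fill_funfact : FunFact :=
  {| E := fun X Y f => Ef f;
     L := fun X Y f => Lf f;
     R := fun X Y f => Rf f;
     RL := fun X Y f => Rf_Lf f;
     Emap := fun X Y X' Y' f g u v h => Emapf h;
     Emap_L := fun X Y X' Y' f g u v h => Emapf_L h;
     Emap_R := fun X Y X' Y' f g u v h => Emapf_R h;
     Emap_id := fun X Y f h => Emapf_id h;
     Emap_comp := fun X Y X' Y' X'' Y'' f g k u v u' v' h1 h2 h3 => Emapf_comp h1 h2 h3 |}.

Definition fill_awfs : AWFS :=
  {| ff := fill_funfact;
     mu := fun X Y f => muf f;
     mu_R := fun X Y f => muf_R f;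
     mu_unit1 := fun X Y f => muf_unit1 f;
     mu_unit2 := fun X Y f h => muf_unit2 h;
     mu_assoc := fun X Y f h => muf_assoc h;
     mu_nat := fun X Y X' Y' f g u v h h' => muf_nat h';
     delta := fun X Y f => deltaf f;
     delta_L := fun X Y f => deltaf_L f;
     delta_counit1 := fun X Y f => deltaf_counit1 f;
     delta_counit2 := fun X Y f h => deltaf_counit2 h;
     delta_coassoc := fun X Y f h => deltaf_coassoc h;
     delta_nat := fun X Y X' Y' f g u v h h' => deltaf_nat h' |}.

Section Interp.
Variables (X Y : cSet) (f : hom X Y) (U : UKF f).

Definition box_over n k e (a : hom (pcube k n) Y) (B : forall p, pbox k n e p -> X p) : Prop :=
  (forall p q (g : Bmor p q) z, B q (act g z) = act g (B p z)) /\
  (forall p z, f p (B p z) = a p (pbox_incl k n e p z)).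

Definition box_hom n k e a B (H : @box_over n k e a B) : hom (pbox k n e) X :=
  @Hom (pbox k n e) X B (proj1 H).

Lemma box_hom_over n k e a B (H : @box_over n k e a B) :
  hcomp f (box_hom H) = hcomp a (pbox_incl k n e).
Proof. by apply: hom_ext => p z; apply: (proj2 H). Qed.

Definition fill_or n k e a (B : forall p, pbox k n e p -> X p) m (d : X m) (c : pcube k n m) :=
  match excluded_middle_informative (box_over a B) with
  | left H => fill U (box_hom_over H) m c
  | right _ => d
  end.

(* On ill-formed boxes the value is junk, read off at [box_point]. *)
Fixpoint interp m (t : term X Y m) : X m :=
  match t with
  | tinj _ x => x
  | tfill m0 n k e a b c =>
      fill_or a (fun p z => interp (b p z)) (interp (b m0 (box_point e c))) c
  end.

Lemma fill_or_eq n k e a B m d c (Bh : hom (pbox k n e) X)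
    (h : hcomp f Bh = hcomp a (pbox_incl k n e)) :
  (forall p z, Bh p z = B p z) -> box_over a B -> @fill_or n k e a B m d c = fill U h m c.
Proof.
move=> E HB; rewrite /fill_or; case: excluded_middle_informative => // H.
by congr (cmp _ m c); apply: fill_congr => //; apply: hom_ext => p z; rewrite E.
Qed.

Lemma interp_congr m n k e a b b' c :
  (forall p z, interp (b p z) = interp (b' p z)) ->
  interp (@tfill X Y m n k e a b c) = interp (tfill a b' c).
Proof.
move=> E; have Eb : (fun p z => interp (b p z)) = (fun p z => interp (b' p z)).
  by apply: functional_extensionality_dep => p; apply: functional_extensionality.
by rewrite /= Eb E.
Qed.

Definition interp_box_over m (t : term X Y m) : Prop :=
  if t is tfill _ _ _ _ a b _ then box_over a (fun p z => interp (b p z)) else True.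

Lemma interp_wf_eqv :
  (forall m t, wf f t -> f m (interp t) = tbase f t /\
     (forall p (g : Bmor m p), interp (tact g t) = act g (interp t)) /\ interp_box_over t) /\
  (forall m t t', eqv f t t' -> @interp m t = interp t').
Proof.
apply: (wf_eqv_mut
  (P := fun m t _ => f m (interp t) = tbase f t /\
          (forall p (g : Bmor m p), interp (tact g t) = act g (interp t)) /\ interp_box_over t)
  (P0 := fun m t t' _ => @interp m t = interp t')) => //.
- move=> m n k e a b c w IHw bb eb IHe.
  have HB : box_over a (fun p z => interp (b p z)).
    split=> [p q g z|p z]; first by rewrite IHe; case: (IHw p z) => _ [-> _].
    by case: (IHw p z) => ->.
  have E m' (c' : pcube k n m') : interp (tfill a b c') = fill U (box_hom_over HB) m' c'.
    exact: fill_or_eq.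
  split; last split=> // p g.
  + by rewrite E; apply: (congr_hom c (fill_base U (box_hom_over HB))).
  + by rewrite [tact _ _]/= !E natural.
- by move=> m t1 t2 t3 _ -> _ ->.
- by move=> m n k e a b b' c _ _ _ _ _; apply: interp_congr.
- move=> m n k e a b z _ [_ [_ HB]].
  rewrite /= (fill_or_eq _ _ (box_hom_over HB)) //.
  exact: (congr_hom z (fill_box U (box_hom_over HB))).
- move=> m n k j e a b al c _ [_ [_ HB]].
  have HB' : box_over (hcomp a (pcube_map n al)) (fun p z => interp (b p (pbox_map n e al p z))).
    split=> [p q g z|p z]; last exact: (proj2 HB).
    by rewrite -(proj1 HB) natural.
  have h' : hcomp f (hcomp (box_hom HB) (pbox_map n e al))
           = hcomp (hcomp a (pcube_map n al)) (pbox_incl j n e).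
    by apply: hom_ext => p z; apply: (proj2 HB).
  rewrite /= (fill_or_eq _ _ (box_hom_over HB)) // (fill_or_eq _ _ h') //.
  exact: (congr_hom c (fill_uniform U (box_hom_over HB) h')).
Qed.

Lemma interp_eqv m (t t' : term X Y m) : eqv f t t' -> interp t = interp t'.
Proof. exact: (proj2 interp_wf_eqv). Qed.

Lemma interp_base m (t : term X Y m) : wf f t -> f m (interp t) = tbase f t.
Proof. by move=> w; case: (proj1 interp_wf_eqv m t w). Qed.

Lemma interp_act m p (g : Bmor m p) (t : term X Y m) :
  wf f t -> interp (tact g t) = act g (interp t).
Proof. by move=> w; case: (proj1 interp_wf_eqv m t w) => _ []. Qed.

Lemma interp_fill m n k e a b c (Bh : hom (pbox k n e) X)
    (h : hcomp f Bh = hcomp a (pbox_incl k n e)) :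
  wf f (@tfill X Y m n k e a b c) -> (forall p z, Bh p z = interp (b p z)) ->
  interp (tfill a b c) = fill U h m c.
Proof.
by move=> w E; apply: fill_or_eq => //; case: (proj1 interp_wf_eqv m _ w) => _ [].
Qed.

Lemma ukf_alg_natural m p (g : Bmor m p) (q : Ef f m) :
  interp (erepr (act g q)) = act g (interp (erepr q)).
Proof. by rewrite -interp_act; [apply/interp_eqv/erepr_eclass | apply: wf_erepr]. Qed.

Definition ukf_alg : hom (Ef f) X :=
  @Hom (Ef f) X (fun m q => interp (erepr q)) ukf_alg_natural.

Lemma ukf_alg_class m (t : term X Y m) (w : wf f t) : ukf_alg m (eclass w) = interp t.
Proof. exact/interp_eqv/erepr_eclass. Qed.

Lemma ukf_alg_R : hcomp f ukf_alg = R fill_awfs f.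
Proof. by apply: hom_ext => m q; apply/interp_base/wf_erepr. Qed.

Lemma ukf_alg_unit : hcomp ukf_alg (L fill_awfs f) = idh X.
Proof. by apply: hom_ext => m x; apply: (ukf_alg_class (wf_inj f x)). Qed.

Lemma ukf_alg_assoc (h : hcomp (idh Y) (R fill_awfs f) = hcomp f ukf_alg) :
  hcomp ukf_alg (mu fill_awfs f) = hcomp ukf_alg (Emap fill_awfs h).
Proof.
apply: Ef_hom_ext => m t w; rewrite !hcompE.
rewrite (muf_class w (wf_tjoin w)) (Emapf_class h w (wf_tmap h w)) !ukf_alg_class.
elim: w => {m t} // m n k e a b c _ IH _ _.
by apply: interp_congr.
Qed.

Definition ralg_of_ukf : RAlg fill_awfs f :=
  @Build_RAlg fill_awfs X Y f ukf_alg ukf_alg_R ukf_alg_unit ukf_alg_assoc.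

End Interp.

Lemma RAlg_ext (W : AWFS) (X Y : cSet) (f : hom X Y) (s t : RAlg W f) : alg s = alg t -> s = t.
Proof.
case: s t => [a1 R1 U1 A1] [a2 R2 U2 A2] /= E; subst.
by congr Build_RAlg; apply: proof_irrelevance.
Qed.

Definition ukf_of_ralg (X Y : cSet) (f : hom X Y) (s : RAlg fill_awfs f) : UKF f :=
  retract_UKF (Rf_Lf f) (alg_R s) (alg_unit s) (Rf_UKF f).

Lemma ralg_unit_class (X Y : cSet) (f : hom X Y) (s : RAlg fill_awfs f) m (x : X m)
    (w : wf f (tinj Y x)) :
  alg s m (eclass w) = x.
Proof.
apply: etrans (congr_hom x (alg_unit s)); rewrite hcompE.
exact/congr1/eclass_eq/eqv_refl/wf_inj.
Qed.

Section AlgFill.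
Variables (X Y : cSet) (f : hom X Y) (s : RAlg fill_awfs f).
Variables (n k : nat) (e : bool) (a : hom (pcube k n) Y).
Variables (b : forall p, pbox k n e p -> term X Y p) (wb : wf_box f a b).

Lemma alg_box_over : hcomp f (hcomp (alg s) (box_class wb)) = hcomp a (pbox_incl k n e).
Proof. by rewrite -hcompA alg_R (Rf_box_class wb). Qed.

(* [muf] and [Emapf] send the formal filler of the box of classes of [b] to the
   formal fillers of [b] and of [alg s \o box_class wb]; associativity of [s]
   identifies their values. *)
Lemma alg_fill_class m (c : pcube k n m) :
  alg s m (fill_class wb m c) = fill (ukf_of_ralg s) alg_box_over m c.
Proof.
pose t := tfill a (fun p z => tinj Y (box_class wb p z)) c.
have wt : wf (Rf f) t.
  apply/wf_fillP; split=> [p z|p z|p q g z]; first exact: wf_inj.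
  - exact: (congr_hom z (Rf_box_class wb)).
  - by rewrite natural; apply/eqv_refl/wf_inj.
have sq : hcomp (idh Y) (R fill_awfs f) = hcomp f (alg s) by rewrite hcomp1h alg_R.
have := congr_hom (A := Ef (Rf f)) (eclass wt) (alg_assoc sq); rewrite !hcompE.
rewrite (muf_class wt (wf_tjoin wt)) (Emapf_class sq wt (wf_tmap sq wt)) => assoc.
have := wf_tjoin wt; have := wf_tmap sq wt.
rewrite /tjoin /tmap !tbind_fill hcomp1h => w1 w2.
transitivity (alg s m (eclass (wf_tjoin wt))).
  congr (alg s m _); apply: eclass_eq; rewrite /tjoin tbind_fill hcomp1h.
  by apply: (eqv_cong (wf_fill_box wb c) w2) => p z; apply/eqv_sym/erepr_eclass.
rewrite assoc; congr (alg s m _); apply: eclass_eq; rewrite /tmap tbind_fill hcomp1h.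
pose wb' := wf_box_erepr (retract_box_over (Rf_Lf f) alg_box_over).
by apply: (eqv_cong w1 (wf_fill_box wb' c)) => p z; apply/eqv_sym/erepr_eclass.
Qed.

End AlgFill.

Section Bijection.
Variables (X Y : cSet) (f : hom X Y).

Lemma interp_ukf_of_ralg (s : RAlg fill_awfs f) m (t : term X Y m) (w : wf f t) :
  interp (ukf_of_ralg s) t = alg s m (eclass w).
Proof.
have w0 := w; move: w0 w; elim=> {m t} [m x|m n k e a b c w IH bb eb] w'.
  by rewrite ralg_unit_class.
have wb : wf_box f a b by split.
rewrite (interp_fill (alg_box_over s wb) w'); last first.
  by move=> p z; rewrite hcompE (IH p z (wf_box_term wb z)).
by rewrite -alg_fill_class; congr (alg s m _); apply/eclass_eq/eqv_refl.
Qed.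

Lemma ralg_ukfK (s : RAlg fill_awfs f) : ralg_of_ukf (ukf_of_ralg s) = s.
Proof.
apply: RAlg_ext; apply: Ef_hom_ext => m t w.
by rewrite ukf_alg_class interp_ukf_of_ralg.
Qed.

Lemma ukf_ralgK (U : UKF f) : ukf_of_ralg (ralg_of_ukf U) = U.
Proof.
apply: UKF_ext => n k e a b h; apply: hom_ext => m c; rewrite hcompE.
pose wb := wf_box_erepr (retract_box_over (Rf_Lf f) h).
apply: etrans (ukf_alg_class U (wf_fill_box wb c)) _.
apply: (interp_fill _ (wf_fill_box wb c)).
by move=> p z; exact: (esym (interp_eqv U (erepr_eclass (wf_inj f (b p z))))).
Qed.

End Bijection.

Section Morphisms.
Variables (X Y X' Y' : cSet) (f : hom X Y) (g : hom X' Y') (u : hom X X') (v : hom Y Y').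
Hypothesis sq : hcomp v f = hcomp g u.

Lemma Emapf_box_over n k e (a : hom (pcube k n) Y) (B : hom (pbox k n e) (Ef f)) :
  hcomp (Rf f) B = hcomp a (pbox_incl k n e) ->
  hcomp (Rf g) (hcomp (Emapf sq) B) = hcomp (hcomp v a) (pbox_incl k n e).
Proof. by move=> hB; rewrite -hcompA Emapf_R hcompA hB -hcompA. Qed.

Lemma Emapf_free_fill n k e (a : hom (pcube k n) Y) (B : hom (pbox k n e) (Ef f)) hB :
  hcomp (Emapf sq) (@free_fill _ _ f n k e a B hB) = free_fill (Emapf_box_over hB).
Proof.
apply: hom_ext => m c; rewrite hcompE.
pose w := wf_fill_box (wf_box_erepr hB) c.
apply: etrans (Emapf_class sq w (wf_tmap sq w)) _; apply: eclass_eq.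
apply: eqv_cong => [||p z]; first exact: (wf_tmap sq w).
- exact: (wf_fill_box (wf_box_erepr (Emapf_box_over hB)) c).
- exact/eqv_sym/erepr_eclass.
Qed.

Lemma ukf_mor_of_ralg_mor (s : RAlg fill_awfs f) (t : RAlg fill_awfs g) :
  RAlg_mor sq s t -> UKF_mor u v (ukf_of_ralg s) (ukf_of_ralg t).
Proof.
move=> st n k e a b h h'.
rewrite /= /retract_fill -hcompA st hcompA Emapf_free_fill; congr hcomp.
by apply: (fill_congr (Rf_UKF g)); rewrite // -hcompA Emapf_L hcompA.
Qed.

Lemma ralg_mor_of_ukf_mor (s : RAlg fill_awfs f) (t : RAlg fill_awfs g) :
  UKF_mor u v (ukf_of_ralg s) (ukf_of_ralg t) -> RAlg_mor sq s t.
Proof.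
move=> st; apply: Ef_hom_ext => m t0 w; rewrite !hcompE.
have w0 := w; move: w0 w; elim=> {m t0} [m x|m n k e a b c w IH bb eb] w0.
  by rewrite ralg_unit_class (Emapf_class sq w0 (wf_inj g (u m x))) ralg_unit_class.
have wb : wf_box f a b by split.
have wb' : wf_box g (hcomp v a) (fun p z => tmap u v (b p z)).
  by apply/(wf_fillP (c := c)); exact: (wf_tmap sq w0).
have B_over : hcomp g (hcomp u (hcomp (alg s) (box_class wb)))
              = hcomp (hcomp v a) (pbox_incl k n e).
  by rewrite -hcompA -sq hcompA alg_box_over -hcompA.
rewrite (Emapf_class sq w0 (wf_fill_box wb' c)).
rewrite (_ : eclass w0 = fill_class wb m c); last exact/eclass_eq/eqv_refl.
rewrite -[eclass _]/(fill_class wb' m c) !alg_fill_class -hcompE (st _ _ _ _ _ _ B_over).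
congr (cmp _ m c); apply: fill_congr => //; apply: hom_ext => p z; rewrite !hcompE.
by apply: etrans (IH p z (wf_box_term wb z)) _; congr (alg t p _); apply: Emapf_class.
Qed.

End Morphisms.

Theorem theorem2p15 :
  exists (W : AWFS)
    (Phi : forall (Y X : cSet) (f : hom Y X), RAlg W f -> UKF f),
    (forall (Y X : cSet) (f : hom Y X), bijective (@Phi Y X f)) /\
    (forall (Y X Y' X' : cSet) (f : hom Y X) (g : hom Y' X')
            (u : hom Y Y') (v : hom X X') (h : hcomp v f = hcomp g u)
            (s : RAlg W f) (t : RAlg W g),
       RAlg_mor h s t <-> UKF_mor u v (Phi _ _ f s) (Phi _ _ g t)).
Proof.
exists fill_awfs, ukf_of_ralg; split=> [Y X f|Y X Y' X' f g u v h s t].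
  by exists (@ralg_of_ukf Y X f); [exact: ralg_ukfK | exact: ukf_ralgK].
by split; [exact: ukf_mor_of_ralg_mor | exact: ralg_mor_of_ukf_mor].
Qed.
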